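(* Let $d\in\{1,2,3\}$, $L_1,\dots,L_d>0$, $r\in(0,1)$, and let the boundary conditions be of bi-Dirichlet, bi-Neumann, or periodic type. For every $M\in\mathbb N_+$ we have the direct sum $$H=\mathcal U_M\oplus\mathcal E_M^\perp,$$ where $H=L^2(\Omega)$, $\mathcal U_M$ is the span of the actuators, and $\mathcal E_M^\perp$ is the orthogonal complement in $H$ of the span $\mathcal E_M$ of the auxiliary eigenfunctions.
   Context: $\Omega=\prod_{n=1}^d(0,L_n)$ in the bi-Dirichlet and bi-Neumann cases; in the periodic case $\Omega$ is the torus $\mathbb T^d_L\sim\prod_{n=1}^d[0,L_n)$. Actuators. For $n\in\{1,\dots,d\}$, $j\in\{1,\dots,M\}$ let $c_{n,j}^M=\frac{(2j-1)L_n}{2M}$ and $\omega_{n,j}^M=(c_{n,j}^M-\frac{rL_n}{2M},c_{n,j}^M+\frac{rL_n}{2M})$. For $\mathbf j=(\mathbf j_1,\dots,\mathbf j_d)\in\{1,\dots,M\}^d$ let $\omega_{\mathbf j}^M=\prod_{n=1}^d\omega_{n,\mathbf j_n}^M$. $\mathcal U_M$ is the linear span of the $M^d$ indicator functions $1_{\omega_{\mathbf j}^M}$. Auxiliary eigenfunctions (of the Laplacian under the corresponding boundary conditions). For $i\in\mathbb N_+$: $e_{n,i}(x_n)=\sin(\frac{i\pi x_n}{L_n})$ (bi-Dirichlet); $e_{n,i}(x_n)=\cos(\frac{(i-1)\pi x_n}{L_n})$ (bi-Neumann); $e_{n,i}(x_n)=\cos(\frac{(i-1)\pi x_n}{L_n})$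 if $i$ is odd and $\sin(\frac{i\pi x_n}{L_n})$ if $i$ is even (periodic). $\mathcal E_M$ is the linear span of the $M^d$ functions $e_{\mathbf j}^M(x)=\prod_{n=1}^de_{n,\mathbf j_n}(x_n)$, $\mathbf j\in\{1,\dots,M\}^d$. Direct sum means $\mathcal U_M+\mathcal E_M^\perp=H$ and $\mathcal U_M\cap\mathcal E_M^\perp=\{0\}$. *)

(* Defs.v *)
From HB Require Import structures.
From mathcomp Require Import all_boot all_order all_algebra.
From mathcomp Require Import all_classical all_reals all_analysis.
From mathcomp Require Import measurable_realfun.
Set Implicit Arguments. Unset Strict Implicit. Unset Printing Implicit Defensive.
Import Order.TTheory GRing.Theory Num.Theory.
Import numFieldNormedType.Exports.
Local Open Scope classical_set_scope.
Local Open Scope ring_scope.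

(* The library provides the type [LspaceType2 mu] of a.e.-classes of square
   integrable real functions, but without any algebraic structure.  The alias
   [L2 mu] is equipped below with its vector space structure: operations are
   computed on representatives and [L2_class] is the quotient map. *)
Section L2_space.
Context d (T : measurableType d) (R : realType).
Variable mu : {measure set T -> \bar R}.

Definition L2 : Type := LspaceType2 mu.
HB.instance Definition _ := gen_eqMixin L2.
HB.instance Definition _ := gen_choiceMixin L2.

Definition L2_fun (u : L2) : T -> R := (u : LspaceType2 mu).
Coercion L2_fun : L2 >-> Funclass.

Lemma measurable_L2_fun (u : L2) : measurable_fun [set: T] (u : T -> R).
Proof.
pose g : {mfun T >-> measurableTypeR R} :=
  repr ((u : LspaceType2 mu) : {mfun_ mu, T >-> measurableTypeR R}).
exact: (@measurable_funPT _ _ _ _ g).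
Qed.

Lemma L2_fun_Lfun (u : L2) : (u : T -> R) \in Lfun mu 2%:E.
Proof.
apply/andP; split; rewrite inE; first exact: measurable_L2_fun.
exact: (@Lebesgue_finite _ _ _ _ _ _ (u : LspaceType2 mu)).
Qed.

Definition L2_rep (u : L2) : LfunType mu (lee1n 2) :=
  Lfun_Sub (lee1n 2) (L2_fun_Lfun u).

Lemma finite_norm2_ae (f g : T -> R) : measurable_fun setT f ->
  measurable_fun setT g -> f = g %[ae mu] ->
  finite_norm mu 2%:E f -> finite_norm mu 2%:E g.
Proof.
move=> mf mg fg; rewrite /finite_norm unlock /=.
suff -> : (\int[mu]_x (`|g x| `^ 2)%:E = \int[mu]_x (`|f x| `^ 2)%:E)%E by [].
apply: ge0_ae_eq_integral => //.
- apply/measurable_EFinP; apply: (measurableT_comp (measurable_powR _)).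
  exact: measurableT_comp.
- apply/measurable_EFinP; apply: (measurableT_comp (measurable_powR _)).
  exact: measurableT_comp.
- exact: (ae_eq_comp (fun t : R => (`|t| `^ 2)%:E) (ae_eq_sym fg)).
Qed.

Section L2_class.
Variable f : LfunType mu (lee1n 2).

Let mf : measurable_fun [set: T] (f : T -> measurableTypeR R).
Proof. exact: (@measurable_funPT _ _ _ _ f). Qed.

Let g : {mfun T >-> measurableTypeR R} :=
  @mfun_Sub _ _ T (measurableTypeR R) _ (mem_set mf).
Let c : {mfun_ mu, T >-> measurableTypeR R} :=
  (\pi_(@aeEqMfun _ _ _ T (measurableTypeR R) mu) g)%qT.

Lemma L2_class_ae_subproof : (c : T -> R) = f %[ae mu].
Proof.
suff : ae_eq_op mu (repr c) g by move/asboolP.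
apply/eqquotP; exact: (reprK c).
Qed.

Let c_finite : finite_norm mu 2%:E c.
Proof.
apply: (@finite_norm2_ae f c).
- exact: (@measurable_funPT _ _ _ _ f).
- exact: (@measurable_funPT _ _ _ _ (repr c)).
- exact: ae_eq_sym L2_class_ae_subproof.
- exact: Lfunction_finite.
Qed.

HB.instance Definition _ :=
  isFinLebesgue.Build d T R mu 2%:E (lee1n 2) c c_finite.
Definition L2_class : L2 := [the LspaceType mu (lee1n 2) of c].

Lemma L2_classE : (L2_class : T -> R) = f %[ae mu].
Proof. exact: L2_class_ae_subproof. Qed.

End L2_class.

Lemma L2_eqP (u v : L2) : u = v <-> (u : T -> R) = v %[ae mu].
Proof.
split=> [->|uv]; first exact: ae_eq_refl.
case: u v uv => [c1 [[h1]]] [c2 [[h2]]] /= E.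
have cE : c1 = c2.
  rewrite -(reprK c1) -(reprK c2).
  by apply/eqP/ae_eqP; exact: E.
by subst c2; rewrite (Prop_irrelevance h1 h2).
Qed.

Lemma L2_repK : cancel L2_rep L2_class.
Proof. by move=> u; apply/L2_eqP/L2_classE. Qed.

Lemma L2_class_eq (f g : LfunType mu (lee1n 2)) :
  (f : T -> R) = g %[ae mu] <-> L2_class f = L2_class g.
Proof.
rewrite L2_eqP; split=> h.
  apply: (ae_eq_trans (L2_classE f)); apply: (ae_eq_trans h).
  exact/ae_eq_sym/L2_classE.
apply: (ae_eq_trans (ae_eq_sym (L2_classE f))).
by apply: (ae_eq_trans h); exact: L2_classE.
Qed.

Definition L2_zero : L2 := L2_class 0.
Definition L2_opp (u : L2) : L2 := L2_class (- L2_rep u).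
Definition L2_add (u v : L2) : L2 := L2_class (L2_rep u + L2_rep v).
Definition L2_scale (a : R) (u : L2) : L2 := L2_class (a *: L2_rep u).

Lemma L2_class_add f g : L2_add (L2_class f) (L2_class g) = L2_class (f + g).
Proof.
apply/L2_class_eq; move: (L2_classE f) (L2_classE g).
rewrite /ae_eq; apply: filterS2 => x hf hg _.
by rewrite -[LHS]/(L2_class f x + L2_class g x) hf// hg.
Qed.

Lemma L2_class_opp f : L2_opp (L2_class f) = L2_class (- f).
Proof.
apply/L2_class_eq; move: (L2_classE f); rewrite /ae_eq.
by apply: filterS => x hf _; rewrite -[LHS]/(- L2_class f x) hf.
Qed.

Lemma L2_class_scale a f : L2_scale a (L2_class f) = L2_class (a *: f).
Proof.
apply/L2_class_eq; move: (L2_classE f); rewrite /ae_eq.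
by apply: filterS => x hf _; rewrite -[LHS]/(a * L2_class f x) hf.
Qed.

Lemma L2_class_ind (P : L2 -> Prop) : (forall f, P (L2_class f)) -> forall u, P u.
Proof. by move=> h u; rewrite -(L2_repK u). Qed.

Lemma L2_addA : associative L2_add.
Proof.
elim/L2_class_ind=> f; elim/L2_class_ind=> g; elim/L2_class_ind=> h.
by rewrite !L2_class_add addrA.
Qed.

Lemma L2_addC : commutative L2_add.
Proof. by elim/L2_class_ind=> f; elim/L2_class_ind=> g; rewrite !L2_class_add addrC. Qed.

Lemma L2_add0 : left_id L2_zero L2_add.
Proof. by elim/L2_class_ind=> f; rewrite !L2_class_add add0r. Qed.

Lemma L2_addN : left_inverse L2_zero L2_opp L2_add.
Proof. by elim/L2_class_ind=> f; rewrite L2_class_opp !L2_class_add addNr. Qed.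

HB.instance Definition _ :=
  GRing.isZmodule.Build L2 L2_addA L2_addC L2_add0 L2_addN.

Lemma L2_classD f g : L2_class (f + g) = L2_class f + L2_class g.
Proof. by rewrite -L2_class_add. Qed.

Lemma L2_classN f : L2_class (- f) = - L2_class f.
Proof. by rewrite -L2_class_opp. Qed.

Lemma L2_scaleA a b u : L2_scale a (L2_scale b u) = L2_scale (a * b) u.
Proof. by elim/L2_class_ind: u => f; rewrite !L2_class_scale scalerA. Qed.

Lemma L2_scale1 : left_id 1 L2_scale.
Proof. by elim/L2_class_ind=> f; rewrite !L2_class_scale scale1r. Qed.

Lemma L2_scaleDr : right_distributive L2_scale +%R.
Proof.
move=> a; elim/L2_class_ind=> f; elim/L2_class_ind=> g.
by rewrite -L2_classD !L2_class_scale scalerDr L2_classD.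
Qed.

Lemma L2_scaleDl u : {morph L2_scale^~ u : a b / a + b}.
Proof.
elim/L2_class_ind: u => f a b.
by rewrite !L2_class_scale scalerDl L2_classD.
Qed.

HB.instance Definition _ := GRing.Zmodule_isLmodule.Build R L2
  L2_scaleA L2_scale1 L2_scaleDr L2_scaleDl.

Lemma L2_classZ a f : L2_class (a *: f) = a *: L2_class f.
Proof. by rewrite -L2_class_scale. Qed.

Lemma L2_addE (u v : L2) : ((u + v : L2) : T -> R) = u \+ v %[ae mu].
Proof. exact: L2_classE. Qed.

Lemma L2_scaleE (a : R) (u : L2) :
  ((a *: u : L2) : T -> R) = (fun x => a * u x) %[ae mu].
Proof. exact: L2_classE. Qed.

End L2_space.

Section lebesgue_tuple.
Variable R : realType.
Local Notation TR := (measurableTypeR R).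
Local Open Scope ereal_scope.

Definition tuple_cons n (z : TR * n.-tuple TR) : n.+1.-tuple TR :=
  [tuple of z.1 :: z.2].

Lemma measurable_tuple_cons n :
  measurable_fun [set: TR * n.-tuple TR] (@tuple_cons n).
Proof. exact: measurable_cons. Qed.

Definition tuple_uncons n (x : n.+1.-tuple TR) : TR * n.-tuple TR :=
  (thead x, [tuple of behead x]).

Lemma measurable_tuple_uncons n :
  measurable_fun [set: n.+1.-tuple TR] (@tuple_uncons n).
Proof.
apply: measurable_fun_pair; first exact: measurable_tnth.
exact: measurable_behead.
Qed.

Section cons_measure.
Variables (n : nat) (mu : {sigma_finite_measure set (n.-tuple TR) -> \bar R}).

Definition cons_measure : set (n.+1.-tuple TR) -> \bar R :=
  pushforward (@lebesgue_measure R \x mu) (@tuple_cons n).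

Let mcons := @measurable_tuple_cons n.

Let cons_measure0 : cons_measure set0 = 0.
Proof. by rewrite /cons_measure /pushforward preimage_set0 measure0. Qed.

Let cons_measure_ge0 A : 0 <= cons_measure A.
Proof. exact: measure_ge0. Qed.

Let cons_measure_sigma_additive : semi_sigma_additive cons_measure.
Proof. exact: measure_semi_sigma_additive. Qed.

HB.instance Definition _ := isMeasure.Build _ _ _ cons_measure
  cons_measure0 cons_measure_ge0 cons_measure_sigma_additive.

Let cons_measure_sigma_finite : sigma_finite setT cons_measure.
Proof.
have /sigma_finiteP[F [TF ndF Foo]] := sigma_finiteT (@lebesgue_measure R).
have /sigma_finiteP[G [TG ndG Goo]] := sigma_finiteT mu.
exists (fun k => @tuple_uncons n @^-1` (F k `*` G k)).
  rewrite -preimage_bigcup predeqE => x; split=> // _; rewrite /= /bigcup /=.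
  have [i _ Fi] : (\bigcup_i F i) (thead x) by rewrite -TF.
  have [j _ Gj] : (\bigcup_i G i) [tuple of behead x] by rewrite -TG.
  exists (maxn i j) => //; split.
    by move: Fi; exact/subsetPset/ndF/leq_maxl.
  by move: Gj; exact/subsetPset/ndG/leq_maxr.
move=> k; have [mF Fk] := Foo k; have [mG Gk] := Goo k; split.
  rewrite -[X in measurable X]setTI; apply: measurable_tuple_uncons => //.
  exact: measurableX.
rewrite /cons_measure /pushforward -comp_preimage.
have -> : @tuple_uncons n \o @tuple_cons n = id.
  apply/funext => -[a t] /=; rewrite /tuple_uncons /tuple_cons theadE /=.
  by congr pair; exact/val_inj.
rewrite preimage_id product_measure1E//.
by rewrite lte_mul_pinfty// ge0_fin_numE.
Qed.

HB.instance Definition _ := Measure_isSigmaFinite.Build _ _ _ cons_measure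
  cons_measure_sigma_finite.

End cons_measure.

(* n-dimensional Lebesgue measure on the Borel sets of R^n, with points of R^n
   represented as tuples: the iterated product of the one-dimensional measure,
   characterized by [lebesgue_tuple_box]. *)
Fixpoint lebesgue_tuple n : {sigma_finite_measure set (n.-tuple TR) -> \bar R} :=
  if n is n'.+1 return {sigma_finite_measure set (n.-tuple TR) -> \bar R}
  then cons_measure (lebesgue_tuple n')
  else @dirac _ (0.-tuple TR) [tuple] R.

Definition box n (A : 'I_n -> set R) : set (n.-tuple TR) :=
  [set x | forall i, A i (tnth x i)].

Lemma measurable_box n (A : 'I_n -> set R) :
  (forall i, measurable (A i)) -> measurable (box A).
Proof.
move=> mA.
rewrite (_ : box A =
  \big[setI/setT]_(i < n) ((@tnth _ TR)^~ i @^-1` A i)).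
  apply: bigsetI_measurable => i _; rewrite -[X in measurable X]setTI.
  exact: (measurable_tnth i measurableT (mA i)).
rewrite -bigcap_seq; apply/seteqP; split=> x /= h i; first by move=> _; exact: h.
by apply: h; rewrite /= mem_index_enum.
Qed.

Lemma lebesgue_tuple_box n (A : 'I_n -> set R) : (forall i, measurable (A i)) ->
  lebesgue_tuple n (box A) = \prod_(i < n) lebesgue_measure (A i).
Proof.
elim: n A => [|n IH] A mA.
  by rewrite big_ord0 /= diracE mem_set// => -[].
rewrite big_ord_recl /= /cons_measure /pushforward.
rewrite (_ : _ @^-1` _ = A ord0 `*` box (fun i => A (lift ord0 i))); last first.
  apply/seteqP; split=> -[a t] /=.
    move=> h; split=> [|i]; first exact: (h ord0).
    by have := h (lift ord0 i); rewrite /tuple_cons tnthS.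
  move=> [a0 h] i; case: (unliftP ord0 i) => [j|] ->; last by rewrite tnth0.
  by rewrite /tuple_cons tnthS; exact: h.
rewrite product_measure1E.
- by rewrite IH.
- exact: mA.
- by apply: measurable_box.
Qed.

End lebesgue_tuple.

Section linear_algebra.
Variables (R : realType) (V : lmodType R).

Definition lspan (I : finType) (v : I -> V) : set V :=
  [set u | exists c : I -> R, u = \sum_i c i *: v i].

Definition direct_sum (U W : set V) : Prop :=
  [set u + w | u in U & w in W] = [set: V] /\ U `&` W = [set 0].

End linear_algebra.

Section L2_inner.
Context d (T : measurableType d) (R : realType).
Variable mu : {measure set T -> \bar R}.

Definition L2_inner (u v : L2 mu) : R := \int[mu]_x (u x * v x).

Definition orthogonal_complement (E : set (L2 mu)) : set (L2 mu) :=
  [set u | forall e, E e -> L2_inner u e = 0].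

End L2_inner.

Lemma bounded_Lfun2 d (T : measurableType d) (R : realType)
    (mu : {finite_measure set T -> \bar R}) (C : R) (f : T -> R) :
  measurable_fun [set: T] f -> (forall x, `|f x| <= C) -> f \in Lfun mu 2%:E.
Proof.
move=> mf fC; apply/andP; split; rewrite inE//=.
rewrite /finite_norm unlock poweR_lty//.
apply: (@le_lt_trans _ _ (\int[mu]_x (C ^+ 2)%:E)%E).
  apply: ge0_le_integral => //=.
  - apply/measurable_EFinP; apply: (measurableT_comp (measurable_powR _)).
    exact: measurableT_comp.
  - move=> x _; rewrite lee_fin powR_mulrn// lerXn2r// nnegrE.
    exact: le_trans (fC x).
rewrite integral_cst// lte_mul_pinfty// ?lee_fin ?sqr_ge0//.
by rewrite -ge0_fin_numE// fin_num_measure.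
Qed.

Inductive boundary_condition := BiDirichlet | BiNeumann | Periodic.

Section setting.
Variable R : realType.
Local Notation TR := (measurableTypeR R).

Section domain.
Variables (bc : boundary_condition) (d : nat) (L : 'I_d -> R).

(* The torus is represented by its fundamental domain, with the Lebesgue
   measure. *)
Definition side (l : R) : set R :=
  if bc is Periodic then [set` `[0, l[] else [set` `]0, l[].

Definition Omega : set (d.-tuple TR) := box (fun n => side (L n)).

Lemma measurable_Omega : measurable Omega.
Proof. by apply: measurable_box => n; rewrite /side; case: bc. Qed.

Definition Omega_measure : set (d.-tuple TR) -> \bar R :=
  mrestr (lebesgue_tuple R d) measurable_Omega.

HB.instance Definition _ := Measure.on Omega_measure.

Let Omega_measure_fin : fin_num_fun Omega_measure.
Proof.
move=> A mA; rewrite ge0_fin_numE//.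
have le : (Omega_measure A <= lebesgue_tuple R d Omega)%E.
  apply: le_measure; rewrite ?inE//; first exact: measurableI measurable_Omega.
  exact: measurable_Omega.
apply: (le_lt_trans le); rewrite lebesgue_tuple_box; last first.
  by move=> n; rewrite /side; case: bc.
suff /andP[_ ->] : (0 <= \prod_(n < d) lebesgue_measure (side (L n)) < +oo)%E by [].
apply: (big_ind (fun x : \bar R => 0 <= x < +oo)%E).
- by rewrite lee01 ltry.
- move=> x y /andP[x0 xoo] /andP[y0 yoo].
  by rewrite mule_ge0//= lte_mul_pinfty// ge0_fin_numE.
- move=> n _; rewrite measure_ge0 /side.
  by case: bc; rewrite lebesgue_measure_itv/=; case: ifPn; rewrite ?ltry ?ltey.
Qed.

HB.instance Definition _ := @Measure_isFinite.Build _ _ _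
  Omega_measure Omega_measure_fin.

Definition L2_Omega := L2 Omega_measure.

End domain.

Section actuators.
Variables (bc : boundary_condition) (d : nat) (L : 'I_d -> R) (r : R) (M : nat).

(* [center] and [omega1] are indexed by 1 <= j <= M; a multi-index in
   {1, .., M}^d is encoded by j : {ffun 'I_d -> 'I_M}, its n-th component
   being (j n).+1.  The same encoding is used for the eigenfunctions. *)
Definition center (l : R) (j : nat) : R := (2 * j%:R - 1) * l / (2 * M%:R).

Definition omega1 (l : R) (j : nat) : set R :=
  [set` `]center l j - r * l / (2 * M%:R), center l j + r * l / (2 * M%:R)[].

Definition omega (j : {ffun 'I_d -> 'I_M}) : set (d.-tuple TR) :=
  box (fun n => omega1 (L n) (j n).+1).

Lemma measurable_omega j : measurable (omega j).
Proof. by apply: measurable_box => n; exact: measurable_itv. Qed.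

Lemma indic_omega_Lfun j :
  (\1_(omega j) : d.-tuple TR -> R) \in Lfun (Omega_measure bc L) 2%:E.
Proof.
apply: (@bounded_Lfun2 _ _ _ _ 1).
  exact: (measurable_indic (measurable_omega j)).
by move=> x; rewrite indicE; case: (_ \in _); rewrite ?normr1 ?normr0.
Qed.

Definition actuator (j : {ffun 'I_d -> 'I_M}) : L2_Omega bc L :=
  L2_class (Lfun_Sub (lee1n 2) (indic_omega_Lfun j)).

Definition actuator_space : set (L2_Omega bc L) := lspan actuator.

End actuators.

Section eigenfunctions.
Variables (bc : boundary_condition) (d : nat) (L : 'I_d -> R) (M : nat).

Definition eigenfun1 (l : R) (i : nat) (x : R) : R :=
  match bc with
  | BiDirichlet => sin (i%:R * pi * x / l)
  | BiNeumann => cos (i.-1%:R * pi * x / l)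
  | Periodic => if odd i then cos (i.-1%:R * pi * x / l)
                else sin (i%:R * pi * x / l)
  end.

Definition eigenfun (j : {ffun 'I_d -> 'I_M}) (x : d.-tuple TR) : R :=
  \prod_(n < d) eigenfun1 (L n) (j n).+1 (tnth x n).

Lemma measurable_eigenfun1 l i : measurable_fun [set: R] (eigenfun1 l i).
Proof.
have lin (a : R) : measurable_fun [set: R] (fun x : R => a * pi * x / l).
  apply: measurable_funM => //; exact: measurable_funM.
have msin : measurable_fun [set: R] (@sin R).
  by apply: continuous_measurable_fun; exact: continuous_sin.
have mcos : measurable_fun [set: R] (@cos R).
  by apply: continuous_measurable_fun; exact: continuous_cos.
by rewrite /eigenfun1; case: bc; [| |case: odd]; exact: measurableT_comp (lin _).
Qed.

Lemma eigenfun_Lfun j : eigenfun j \in Lfun (Omega_measure bc L) 2%:E.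
Proof.
apply: (@bounded_Lfun2 _ _ _ _ 1).
  apply: measurable_prod => n _.
  apply: (measurableT_comp (measurable_eigenfun1 _ _)).
  exact: measurable_tnth.
move=> x; rewrite normr_prod; apply: prodr_ile1 => n _; rewrite normr_ge0/=.
have s1 (t : R) : `|sin t| <= 1 by rewrite ler_norml sin_geN1 sin_le1.
have c1 (t : R) : `|cos t| <= 1 by rewrite ler_norml cos_geN1 cos_le1.
by rewrite /eigenfun1; case: bc; [| | case: odd].
Qed.

Definition aux_eigenfun (j : {ffun 'I_d -> 'I_M}) : L2_Omega bc L :=
  L2_class (Lfun_Sub (lee1n 2) (eigenfun_Lfun j)).

Definition eigenfun_space : set (L2_Omega bc L) := lspan aux_eigenfun.

End eigenfunctions.
End setting.

Arguments actuator_space {R} bc {d} L r M.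
Arguments eigenfun_space {R} bc {d} L M.

(* Main.v *)
Require Import Defs.
From mathcomp Require Import all_boot all_order all_algebra.
From mathcomp Require Import all_classical all_reals all_analysis.
From mathcomp Require Import measurable_realfun.
From mathcomp Require Import ring lra zify.
Import Order.TTheory GRing.Theory Num.Theory.
Import numFieldNormedType.Exports.
Set Implicit Arguments. Unset Strict Implicit. Unset Printing Implicit Defensive.
Local Open Scope classical_set_scope.
Local Open Scope ring_scope.

(** The orthogonal complement of a span of finitely many vectors [w] is a
complement of the span of [v], where both families have the same index set,
as soon as the matrix of the inner products of [v] with [w] is invertible:
the projection of [u] has the coordinates that solve the linear system
obtained by pairing with every [w j], and invertibility gives existence and
uniqueness of these coordinates ([direct_sum_of_pairing]).  So the point is the
invertibility of the matrix of inner products of actuators and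
eigenfunctions.

Since actuators and eigenfunctions are both products of functions of one
variable, Fubini's theorem shows that this matrix is the tensor product of
one-dimensional matrices, one for each coordinate
([inner_actuator_eigenfun]), and a tensor product of invertible matrices is
invertible ([tensor_unit]).

The one-dimensional entries are integrals of a sine or a cosine over an
interval centered at [c_i].  By the addition formulas such an integral is
the value at [c_i] times a factor that depends only on the frequency
([Rintegral_trig]); the factor is nonzero because [r < 1] keeps half the length
of the interval times the frequency below [pi].  It remains to invert the matrix
of the values [e_j (c_i)].  The centers are the midpoints of [M] equal cells, and
on these nodes the first [M] modes are orthogonal for the counting inner
product (the discrete sine, cosine and Fourier transforms), with nonzero
norms.  Hence the product of the transpose of the matrix with the matrix is
an invertible diagonal matrix ([collocation_unit]). *)

(** * Discrete orthogonality of sines and cosines *)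

Section trigonometric_sums.
Variable R : realType.
Implicit Types (t x : R) (b : bool).

(** The boolean form lets the three boundary conditions share all proofs. *)
Definition trig b : R -> R := if b then cos else sin.

(** The summands multiplied by [2 sin t] are increments of [sin (2 j t)], so
the sum telescopes. *)
Lemma sum_cos_odd t n :
  2 * sin t * (\sum_(j < n) cos ((2 * j%:R + 1) * t)) = sin (2 * n%:R * t).
Proof.
elim: n => [|n IH]; first by rewrite big_ord0 mulr0 mulr0 mul0r sin0.
rewrite big_ord_recr /= mulrDr IH.
have -> : 2 * n%:R * t = (2 * n%:R + 1) * t - t by ring.
have -> : 2 * n.+1%:R * t = (2 * n%:R + 1) * t + t by rewrite -natr1; ring.
by rewrite sinB sinD; ring.
Qed.

Lemma sum_sin_odd t n :
  2 * sin t * (\sum_(j < n) sin ((2 * j%:R + 1) * t)) = 1 - cos (2 * n%:R * t).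
Proof.
elim: n => [|n IH]; first by rewrite big_ord0 mulr0 mulr0 mul0r cos0 subrr.
rewrite big_ord_recr /= mulrDr IH.
have -> : 2 * n%:R * t = (2 * n%:R + 1) * t - t by ring.
have -> : 2 * n.+1%:R * t = (2 * n%:R + 1) * t + t by rewrite -natr1; ring.
by rewrite cosB cosD; ring.
Qed.

Lemma sin_natpi n : sin (n%:R * pi) = 0 :> R.
Proof.
elim: n => [|n IH]; first by rewrite mul0r sin0.
by rewrite -natr1 mulrDl mul1r sinDpi IH oppr0.
Qed.

Lemma cos_evenpi n : ~~ odd n -> cos (n%:R * pi) = 1 :> R.
Proof.
move=> /even_halfK <-; elim: n./2 => [|k IH]; first by rewrite mul0r cos0.
by rewrite doubleS -!natr1 !mulrDl mul1r !cosDpi IH opprK.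
Qed.

Lemma sin_neq0 x : 0 < `|x| < pi -> sin x != 0.
Proof.
move=> xpi; have [x0|x0|x0] := ltgtP x 0.
- have := sin_gt0_pi xpi; rewrite ltr0_norm// sinN oppr_gt0.
  by move/lt_eqF ->.
- by have := sin_gt0_pi xpi; rewrite gtr0_norm// => /gt_eqF ->.
- by move: xpi; rewrite x0 normr0 ltxx.
Qed.

Section discrete_orthogonality.
Variable M : nat.
Hypothesis M0 : (0 < M)%N.
Let phi : R := pi / (2 * M%:R).

Let phi0 : 0 < phi.
Proof. by rewrite divr_gt0 ?pi_gt0// mulr_gt0 ?ltr0n. Qed.

Let phiE : 2 * M%:R * phi = pi.
Proof. by rewrite /phi mulrC divfK// mulf_neq0 ?pnatr_eq0 -?lt0n. Qed.

Let sin_phi_eq0 x : `|x| < 2 * M%:R -> sin (x * phi) = 0 -> x = 0.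
Proof.
move=> xM /eqP; have [//|x0] := eqVneq x 0; apply: contraTeq => _.
apply: sin_neq0; rewrite normrM (gtr0_norm phi0) -phiE.
by rewrite mulr_gt0 ?normr_gt0//= ltr_pM2r.
Qed.

(** The centers of the cells after rescaling the side to length [pi]. *)
Definition node (j : nat) : R := (2 * j%:R + 1) * phi.

Let sum_cos_node x : `|x| < 2 * M%:R -> x != 0 -> sin (x * pi) = 0 ->
  \sum_(j < M) cos (x * node j) = 0.
Proof.
move=> xM x0 xpi; have /eqP := sum_cos_odd (x * phi) M.
rewrite (_ : 2 * M%:R * _ = x * pi) ?xpi; last by rewrite mulrCA phiE.
rewrite !mulf_eq0 pnatr_eq0/= => /orP[/eqP/(sin_phi_eq0 xM)/eqP|/eqP S0].
  by rewrite (negbTE x0).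
by rewrite -[RHS]S0; apply: eq_bigr => j _; rewrite mulrCA.
Qed.

Let sum_sin_node x : `|x| < 2 * M%:R -> cos (x * pi) = 1 ->
  \sum_(j < M) sin (x * node j) = 0.
Proof.
move=> xM xpi; have [->|x0] := eqVneq x 0.
  by apply: big1 => j _; rewrite mul0r sin0.
have /eqP := sum_sin_odd (x * phi) M.
rewrite (_ : 2 * M%:R * _ = x * pi) ?xpi ?subrr; last by rewrite mulrCA phiE.
rewrite !mulf_eq0 pnatr_eq0/= => /orP[/eqP/(sin_phi_eq0 xM)/eqP|/eqP S0].
  by rewrite (negbTE x0).
by rewrite -[RHS]S0; apply: eq_bigr => j _; rewrite mulrCA.
Qed.

Let norm_freq (p q : nat) : (p + q < 2 * M)%N ->
  `|p%:R - q%:R : R| < 2 * M%:R /\ `|p%:R + q%:R : R| < 2 * M%:R.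
Proof.
move=> pqM; have : (p%:R + q%:R : R) < 2 * M%:R by rewrite -natrD -natrM ltr_nat.
have p0 : 0 <= p%:R :> R by [].
have q0 : 0 <= q%:R :> R by [].
by move=> ?; rewrite !ltr_norml; split; apply/andP; split; lra.
Qed.

(** A product of two cosines or of two sines is a combination of cosines of the
frequencies [p - q] and [p + q].  Both are nonzero and below [2 M] in absolute
value, so the telescoped sums vanish without a zero denominator. *)
Lemma trig_orthogonal b (p q : nat) : p != q -> (p + q < 2 * M)%N ->
  \sum_(j < M) trig b (p%:R * node j) * trig b (q%:R * node j) = 0.
Proof.
move=> pq /norm_freq[MB MD].
have pB : (p%:R - q%:R : R) != 0 by rewrite subr_eq0 eqr_nat.
have pD : (p%:R + q%:R : R) != 0.
  by rewrite -natrD pnatr_eq0; move: pq; case: p q {MB MD pB} => [|?] [].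
have CB : \sum_(j < M) cos ((p%:R - q%:R) * node j) = 0.
  by apply: sum_cos_node => //; rewrite mulrBl sinB !sin_natpi; ring.
have CD : \sum_(j < M) cos ((p%:R + q%:R) * node j) = 0.
  by apply: sum_cos_node => //; rewrite mulrDl sinD !sin_natpi; ring.
transitivity (2^-1 * (\sum_(j < M) cos ((p%:R - q%:R) * node j)
   + (-1) ^+ (~~ b) * \sum_(j < M) cos ((p%:R + q%:R) * node j))).
  rewrite [X in _ + X]mulr_sumr -big_split mulr_sumr /=; apply: eq_bigr => j _.
  by rewrite mulrBl mulrDl cosB cosD; case: b => /=; field.
by rewrite CB CD mulr0 addr0 mulr0.
Qed.

(** The sum of the sines telescopes to [1 - cos (x pi)], which vanishes only
for even frequencies [x]: this is where the periodic modes must have even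
frequencies. *)
Lemma trig_cross_orthogonal b (p q : nat) : ~~ odd p -> ~~ odd q ->
    (p + q < 2 * M)%N ->
  \sum_(j < M) trig b (p%:R * node j) * trig (~~ b) (q%:R * node j) = 0.
Proof.
move=> ep eq /norm_freq[MB MD].
have SB : \sum_(j < M) sin ((p%:R - q%:R) * node j) = 0.
  apply: sum_sin_node => //.
  by rewrite mulrBl cosB !cos_evenpi// !sin_natpi; ring.
have SD : \sum_(j < M) sin ((p%:R + q%:R) * node j) = 0.
  apply: sum_sin_node => //.
  by rewrite mulrDl cosD !cos_evenpi// !sin_natpi; ring.
transitivity (2^-1 * (\sum_(j < M) sin ((p%:R + q%:R) * node j)
   - (-1) ^+ (~~ b) * \sum_(j < M) sin ((p%:R - q%:R) * node j))).
  rewrite [X in _ - X]mulr_sumr -sumrB mulr_sumr /=; apply: eq_bigr => j _.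
  by rewrite mulrBl mulrDl sinB sinD; case: b => /=; field.
by rewrite SB SD mulr0 subr0 mulr0.
Qed.

(** A sum of squares is nonzero once one term is, and the mode is positive at
the first node: the bounds on [p] place its argument in [`]0, pi[] for a sine,
and in [`[0, pi / 2[] for a cosine. *)
Lemma trig_sqr_sum_neq0 b (p : nat) : (~~ b <= p)%N -> (p + b <= M)%N ->
  \sum_(j < M) trig b (p%:R * node j) * trig b (p%:R * node j) != 0.
Proof.
move=> bp pM.
have M' : (0 < M%:R :> R) by rewrite ltr0n.
have h : 0 < trig b (p%:R * node 0).
  rewrite /node mulr0 add0r mul1r.
  have pi0 := pi_gt0 R.
  have halfpi : M%:R * phi = pi / 2 by rewrite -phiE; field.
  have le (q : nat) : (q <= M)%N -> q%:R * phi <= pi / 2.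
    by move=> qM; rewrite -halfpi ler_pM2r// ler_nat.
  case: b bp pM => /= bp pM.
    have := le _ pM; rewrite natrD mulrDl mul1r => leM.
    apply: cos_gt0_pihalf; apply/andP; split.
      by apply: (@lt_le_trans _ _ 0); [lra|rewrite mulr_ge0// ltW].
    by apply: lt_le_trans leM; rewrite ltrDl.
  rewrite addn0 in pM; have leM := le _ pM.
  apply: sin_gt0_pi; rewrite mulr_gt0 ?ltr0n//=.
  by apply: le_lt_trans leM _; lra.
rewrite gt_eqF// (bigD1 (Ordinal M0))//= ltr_wpDr//.
  by apply: sumr_ge0 => j _; rewrite -expr2 sqr_ge0.
by rewrite -expr2 exprn_gt0.
Qed.

End discrete_orthogonality.
End trigonometric_sums.

(** * One-dimensional collocation matrix *)

Definition mode_is_cos bc (i : nat) : bool :=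
  match bc with BiDirichlet => false | BiNeumann => true | Periodic => odd i end.

Definition mode_freq bc (i : nat) : nat := if mode_is_cos bc i then i.-1 else i.

Lemma even_mode_freq_periodic i : ~~ odd (mode_freq Periodic i.+1).
Proof. by rewrite /mode_freq /=; case: (boolP (odd i)) => //= ->. Qed.

(** Besides making [trig_sqr_sum_neq0] applicable, these bounds make the sum of
two distinct frequencies, or of a sine and a cosine frequency, smaller than
[2 M].  A sine can reach [M], a cosine cannot. *)
Lemma mode_freq_bounds bc (M j : nat) : (j < M)%N ->
  (~~ mode_is_cos bc j.+1 <= mode_freq bc j.+1)%N /\
  (mode_freq bc j.+1 + mode_is_cos bc j.+1 <= M)%N.
Proof. by rewrite /mode_freq; case: mode_is_cos => /=; lia. Qed.

Lemma eigenfun1E (R : realType) bc (l : R) i (x : R) :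
  eigenfun1 bc l i x = trig (mode_is_cos bc i) ((mode_freq bc i)%:R * pi / l * x).
Proof.
have E (k : nat) : k%:R * pi * x / l = k%:R * pi / l * x by rewrite mulrAC.
by rewrite /eigenfun1 /mode_freq; case: bc => /=; rewrite !E//; case: (odd i).
Qed.

Section collocation.
Variables (R : realType) (bc : boundary_condition) (l : R) (M : nat).
Hypotheses (l0 : 0 < l) (M0 : (0 < M)%N).

Definition collocation_mx : 'M[R]_M :=
  \matrix_(i, j) eigenfun1 bc l j.+1 (Defs.center M l i.+1).

Lemma collocation_mxE i j : collocation_mx i j =
  trig (mode_is_cos bc j.+1) ((mode_freq bc j.+1)%:R * node R M i).
Proof.
rewrite mxE eigenfun1E /Defs.center /node -natr1; congr trig.
have M' : (M%:R : R) != 0 by rewrite pnatr_eq0 -lt0n.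
have l' := gt_eqF l0; field.
by rewrite M' l'.
Qed.

(** Discrete orthogonality says that the Gram matrix of the columns is diagonal,
and its diagonal entries are the nonzero discrete norms. *)
Lemma collocation_unit : collocation_mx \in unitmx.
Proof.
pose gram := collocation_mx^T *m collocation_mx.
have gramE i j : gram i j = \sum_k collocation_mx k i * collocation_mx k j.
  by rewrite mxE; apply: eq_bigr => k _; rewrite mxE.
have diag_gram : gram = diag_mx (\row_j gram j j).
  apply/matrixP => i j; rewrite [RHS]mxE [X in X *+ _]mxE.
  have [<-|ij] := eqVneq i j; first by rewrite mulr1n.
  rewrite mulr0n gramE; under eq_bigr do rewrite !collocation_mxE.
  have [bi fi] := mode_freq_bounds bc (ltn_ord i).
  have [bj fj] := mode_freq_bounds bc (ltn_ord j).
  have ij' : (i : nat) != j := ij.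
  have [e|ne] := eqVneq (mode_is_cos bc i.+1) (mode_is_cos bc j.+1).
    rewrite -e; apply: trig_orthogonal => //.
      by rewrite /mode_freq -e; case: ifP.
    by move: fi fj ij'; rewrite /mode_freq -e; case: ifP; lia.
  have -> : mode_is_cos bc j.+1 = ~~ mode_is_cos bc i.+1.
    by move: ne; case: mode_is_cos; case: mode_is_cos.
  apply: trig_cross_orthogonal => //.
  - by move: ne; case: bc => // _; exact: even_mode_freq_periodic.
  - by move: ne; case: bc => // _; exact: even_mode_freq_periodic.
  - by move: ne fi fj ij'; case: mode_is_cos; case: mode_is_cos => //=; lia.
suff : gram \in unitmx by rewrite unitmx_mul => /andP[].
rewrite diag_gram unitmxE det_diag unitfE; apply/prodf_neq0 => j _.
rewrite mxE gramE; under eq_bigr do rewrite !collocation_mxE.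
by have [bj fj] := mode_freq_bounds bc (ltn_ord j); exact: trig_sqr_sum_neq0.
Qed.

End collocation.

(** * Integrals over the actuator intervals *)

Lemma continuous_trig (R : realType) b (k : R) :
  continuous (fun x : R => trig b (k * x)).
Proof.
move=> x; apply: (@continuous_comp _ _ _ (fun x => k * x)).
  exact: (cvgM (cvg_cst _) cvg_id).
by case: b; [exact: continuous_cos|exact: continuous_sin].
Qed.

Lemma continuous_eigenfun1 (R : realType) bc (l : R) i :
  continuous (eigenfun1 bc l i).
Proof.
by rewrite (funext (eigenfun1E bc l i)); exact: continuous_trig.
Qed.

Section interval_integrals.
Variable R : realType.
Local Notation mu := (@lebesgue_measure R).

Lemma Rintegral_itv_is_derive (f F : R -> R) (a b : R) : a < b ->
  continuous f -> (forall x : R, is_derive x (1 : R) F (f x)) ->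
  \int[mu]_(x in [set` `]a, b[]) f x = F b - F a.
Proof.
move=> ab cf dF; rewrite /Rintegral.
have mf : measurable_fun [set: R] f by exact: continuous_measurable_fun.
have cF : continuous F.
  by move=> x; apply/differentiable_continuous/derivable1_diffP; exact: ex_derive.
rewrite -(@integral_itv_bndoo _ _ _ _ true false); last first.
  exact/measurable_EFinP/measurable_funTS.
rewrite (@continuous_FTC2 _ f F)//.
- by apply: continuous_subspaceT.
- split=> [x _||]; first exact: ex_derive.
  + exact/cvg_at_right_filter/cF.
  + exact/cvg_at_left_filter/cF.
- by move=> x _; rewrite derive1E derive_val.
Qed.

(** The integral of [cos (k x)] over [`]- delta, delta[]. *)
Definition window_gain (k delta : R) : R :=
  if k == 0 then 2 * delta else 2 * sin (k * delta) / k.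

(** In the addition formulas at [c], the part that is odd around [c] integrates
to zero, so only a multiple of the value at [c] remains. *)
Lemma Rintegral_trig b (k c delta : R) : 0 < delta ->
  \int[mu]_(x in [set` `]c - delta, c + delta[]) trig b (k * x)
  = window_gain k delta * trig b (k * c).
Proof.
move=> d0; have ab : c - delta < c + delta by lra.
have ctrig := @continuous_trig R b k.
(* At frequency zero the usual primitive would divide by zero. *)
pose F (x : R) : R := if k == 0 then (if b then x else 0) else
   (if b then sin (k * x) else - cos (k * x)) / k.
have dF (x : R) : is_derive x (1 : R) F (trig b (k * x)).
  rewrite /F /trig; case: (eqVneq k 0) => k0.
    by case: b {ctrig F}; rewrite k0 mul0r ?cos0 ?sin0; apply: is_derive_eq.
  by case: b {ctrig F}; apply: is_derive_eq; rewrite /GRing.scale/=; field.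
rewrite (Rintegral_itv_is_derive ab ctrig dF) {dF}.
rewrite /F /window_gain; case: (eqVneq k 0) => k0.
  by case: b {ctrig F}; rewrite k0 mul0r /= ?cos0 ?sin0; ring.
by case: b {ctrig F} => /=; rewrite mulrBr mulrDr ?(sinD, cosD) sinN cosN; field.
Qed.

Lemma window_gain_neq0 (k delta : R) : 0 < delta -> 0 <= k -> k * delta < pi ->
  window_gain k delta != 0.
Proof.
move=> d0 k0 kd; rewrite /window_gain; have [_|kn0] := eqVneq k 0; first by lra.
have kp : 0 < k by rewrite lt_neqAle eq_sym kn0.
by rewrite gt_eqF// divr_gt0// mulr_gt0// sin_gt0_pi// mulr_gt0.
Qed.

End interval_integrals.

Section pairing1.
Variables (R : realType) (bc : boundary_condition) (r : R) (M : nat).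
Hypotheses (r01 : 0 < r < 1) (M0 : (0 < M)%N).

Definition pairing1_mx (l : R) : 'M[R]_M := \matrix_(i, j)
  \int[@lebesgue_measure R]_(x in omega1 r M l i.+1) eigenfun1 bc l j.+1 x.

(** Integrating over the actuators multiplies each column of the collocation
matrix by the gain of its frequency. *)
Lemma pairing1_unit (l : R) : 0 < l -> pairing1_mx l \in unitmx.
Proof.
move=> l0; have /andP[r0 r1] := r01; have M' : 0 < M%:R :> R by rewrite ltr0n.
pose delta := r * l / (2 * M%:R); have d0 : 0 < delta by rewrite divr_gt0 ?mulr_gt0.
pose k (j : 'I_M) : R := (mode_freq bc j.+1)%:R * pi / l.
have -> : pairing1_mx l = collocation_mx bc l M *m
    diag_mx (\row_j window_gain (k j) delta).
  apply/matrixP => i j; rewrite mul_mx_diag !mxE eigenfun1E mulrC.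
  under eq_Rintegral do rewrite eigenfun1E.
  exact: Rintegral_trig.
rewrite unitmx_mul collocation_unit//= unitmxE det_diag unitfE.
apply/prodf_neq0 => j _; rewrite mxE window_gain_neq0//.
  by rewrite divr_ge0 ?mulr_ge0 ?pi_ge0// ltW.
(* The frequency is at most [M], so this product is at most [r * pi / 2]. *)
have -> : k j * delta = (mode_freq bc j.+1)%:R / M%:R * (r / 2) * pi.
  by rewrite /k /delta; field; rewrite !gt_eqF.
rewrite -[ltRHS]mul1r ltr_pM2r ?pi_gt0//.
have [_ fj] := mode_freq_bounds bc (ltn_ord j).
have : (mode_freq bc j.+1)%:R / M%:R <= 1 :> R.
  by rewrite ler_pdivrMr// mul1r ler_nat; move: fj; lia.
have : 0 <= (mode_freq bc j.+1)%:R / M%:R :> R by rewrite divr_ge0.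
by nra.
Qed.

End pairing1.

(** * Invertible pairings and direct sums *)

(** The inverse is the tensor product of the inverses: expanding the product of
the one-dimensional matrix products over all multi-indices gives the sum over
[j].  Both one-sided inverses are kept because existence and uniqueness in
[direct_sum_of_pairing] use different sides. *)
Lemma tensor_unit (R : comUnitRingType) (d M : nat) (A : 'I_d -> 'M[R]_M) :
    (forall n, A n \in unitmx) ->
  exists H : {ffun 'I_d -> 'I_M} -> {ffun 'I_d -> 'I_M} -> R,
   (forall i k : {ffun 'I_d -> 'I_M},
      \sum_(j : {ffun 'I_d -> 'I_M}) (\prod_n A n (i n) (j n)) * H j k = (i == k)%:R) /\
   (forall i k : {ffun 'I_d -> 'I_M},
      \sum_(j : {ffun 'I_d -> 'I_M}) H i j * (\prod_n A n (j n) (k n)) = (i == k)%:R).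
Proof.
move=> uA.
have tensor (X Y : 'I_d -> 'M[R]_M) (i k : {ffun 'I_d -> 'I_M}) :
    (forall n, X n *m Y n = 1%:M) ->
    \sum_(j : {ffun 'I_d -> 'I_M}) (\prod_n X n (i n) (j n)) *
       (\prod_n Y n (j n) (k n)) = (i == k)%:R.
  move=> XY; under eq_bigr do rewrite -big_split /=.
  rewrite -(bigA_distr_bigA (fun n j => X n (i n) j * Y n j (k n))).
  transitivity (\prod_n (i n == k n)%:R : R).
    apply: eq_bigr => n _; have := congr1 (fun Z : 'M[R]_M => Z (i n) (k n)) (XY n).
    by rewrite !mxE.
  have [->|ik] := eqVneq i k; first by apply: big1 => n _; rewrite eqxx.
  have [n nik] : exists n, i n != k n.
    apply/existsP; apply: contraNT ik; rewrite negb_exists => /forallP h.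
    by apply/eqP/ffunP => n; apply/eqP; rewrite -[_ == _]negbK h.
  by rewrite (bigD1 n)//= (negbTE nik) mul0r.
exists (fun i j => \prod_n invmx (A n) (i n) (j n)); split=> i k.
  by apply: (tensor A (fun n => invmx (A n))) => n; exact: mulmxV.
by apply: (tensor (fun n => invmx (A n)) A) => n; exact: mulVmx.
Qed.

(** [H] is the inverse of the matrix of the pairing.  The left inverse identity
(the last hypothesis) gives the decomposition of any vector, the right inverse
one gives the uniqueness. *)
Lemma direct_sum_of_pairing (R : realType) (V : lmodType R) (I : finType)
    (b : V -> V -> R) (v w : I -> V) (H : I -> I -> R) :
  (forall a u u' e, b (a *: u + u') e = a * b u e + b u' e) ->
  (forall a u e e', b u (a *: e + e') = a * b u e + b u e') ->
  (forall i k, \sum_j b (v i) (w j) * H j k = (i == k)%:R) ->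
  (forall i k, \sum_j H i j * b (v j) (w k) = (i == k)%:R) ->
  direct_sum (lspan v) [set u | forall e, lspan w e -> b u e = 0].
Proof.
move=> bl br GH HG.
have b0l e : b 0 e = 0.
  have := bl 1 0 0 e; rewrite scaler0 addr0 mul1r => /eqP.
  by rewrite -subr_eq0 opprD addNKr oppr_eq0 => /eqP.
have b0r u : b u 0 = 0.
  have := br 1 u 0 0; rewrite scaler0 addr0 mul1r => /eqP.
  by rewrite -subr_eq0 opprD addNKr oppr_eq0 => /eqP.
have bsuml (c : I -> R) e : b (\sum_i c i *: v i) e = \sum_i c i * b (v i) e.
  elim: (index_enum I) => [|i s IH]; first by rewrite !big_nil.
  by rewrite !big_cons bl IH.
have bsumr u (c : I -> R) : b u (\sum_i c i *: w i) = \sum_i c i * b u (w i).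
  elim: (index_enum I) => [|i s IH]; first by rewrite !big_nil.
  by rewrite !big_cons br IH.
have delta (c : I -> R) k : \sum_i c i * (i == k)%:R = c k.
  rewrite (bigD1 k)//= eqxx mulr1 big1 ?addr0// => i /negbTE ->.
  by rewrite mulr0.
split; apply/seteqP; split=> u //=.
- move=> _; pose c i := \sum_k b u (w k) * H k i.
  pose p := \sum_i c i *: v i.
  exists p; first by exists c.
  exists (u - p); last by rewrite addrC subrK.
  move=> _ [a ->]; rewrite bsumr; apply: big1 => k _.
  rewrite (_ : u - p = (-1) *: p + u); last by rewrite scaleN1r addrC.
  rewrite bl bsuml mulN1r (_ : \sum_i _ = b u (w k)) ?addNr ?mulr0//.
  rewrite /c; under eq_bigr do rewrite mulr_suml.
  rewrite exchange_big /= -[RHS](delta (fun j => b u (w j))).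
  apply: eq_bigr => j _; rewrite -HG mulr_sumr.
  by apply: eq_bigr => i _; rewrite mulrA.
- move=> [[c uE] uperp]; suff c0 k : c k = 0.
    by rewrite uE; apply: big1 => k _; rewrite c0 scale0r.
  rewrite -(delta c k); under eq_bigr do rewrite -GH mulr_sumr.
  rewrite exchange_big /=; apply: big1 => j _.
  under eq_bigr do rewrite mulrA.
  rewrite -mulr_suml -bsuml -uE uperp ?mul0r//.
  exists (fun i => (i == j)%:R); rewrite (bigD1 j)//= eqxx scale1r big1 ?addr0//.
  by move=> i /negbTE ->; rewrite scale0r.
- move=> ->; split; last by move=> e _; exact: b0l.
  by exists (fun=> 0); rewrite big1// => i _; rewrite scale0r.
Qed.

(** * Integrals of product functions *)

Section product_functions.
Context d1 d2 (T1 : measurableType d1) (T2 : measurableType d2) (R : realType).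
Variable m1 : {sigma_finite_measure set T1 -> \bar R}.
Variable m2 : {sigma_finite_measure set T2 -> \bar R}.
Variables (f : T1 -> R) (g : T2 -> R).
Hypothesis fint : m1.-integrable setT (EFin \o f).
Hypothesis gint : m2.-integrable setT (EFin \o g).

Let h (z : T1 * T2) : R := f z.1 * g z.2.

Lemma integrable_prod_fun : (m1 \x m2)%E.-integrable setT (EFin \o h).
Proof.
have /integrableP[/measurable_EFinP mf foo] := fint.
have /integrableP[/measurable_EFinP mg goo] := gint.
apply/integrable12ltyP => /=.
  apply/measurable_EFinP; apply: measurable_funM.
    exact: measurableT_comp mf _.
  exact: measurableT_comp mg _.
have inner x : (\int[m2]_y `|(h (x, y))%:E| =
    `|f x|%:E * \int[m2]_y `|(g y)%:E|)%E.
  rewrite -ge0_integralZl_EFin//; last first.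
    by apply: measurableT_comp => //; exact/measurable_EFinP.
  by apply: eq_integral => y _; rewrite /h /= normrM EFinM.
under eq_integral do rewrite inner.
rewrite ge0_integralZr//; last first.
- exact: integral_ge0.
- by apply/measurable_EFinP; exact: measurableT_comp.
rewrite lte_mul_pinfty//; first exact: integral_ge0.
by rewrite ge0_fin_numE//; exact: integral_ge0.
Qed.

Lemma Rintegral_prod_fun :
  \int[(m1 \x m2)%E]_z h z = (\int[m1]_x f x) * (\int[m2]_y g y).
Proof.
rewrite /Rintegral -(integral12_prod_meas1 integrable_prod_fun) /fubini_F /=.
under eq_integral => x _.
  under eq_integral do rewrite /h /= EFinM.
  rewrite integralZl//.
  over.
have fgint : (\int[m2]_y (g y)%:E)%E \is a fin_num by exact: integrable_fin_num gint.
rewrite -(fineK fgint) integralZr// fineM//.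
exact: integrable_fin_num fint.
Qed.

End product_functions.

Section tuple_functions.
Variable R : realType.
Local Notation mu := (@lebesgue_measure R).

(** Integrability is part of the induction because Fubini's theorem for the
next coordinate needs it. *)
Lemma tuple_prod_fun n (f : 'I_n -> R -> R) :
    (forall i, mu.-integrable setT (EFin \o f i)) ->
  (lebesgue_tuple R n).-integrable setT
    (EFin \o (fun x => \prod_(i < n) f i (tnth x i))) /\
  \int[lebesgue_tuple R n]_x (\prod_(i < n) f i (tnth x i))
    = \prod_(i < n) \int[mu]_x f i x.
Proof.
elim: n f => [|n IH] f fint.
  split.
    apply: (eq_integrable _ (cst 1%:E)) => //.
      by move=> x _; rewrite /= big_ord0.
    by apply: finite_measure_integrable_cst.
  rewrite big_ord0; under eq_Rintegral do rewrite big_ord0.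
  rewrite Rintegral_cst// mul1r; transitivity (fine (1%E : \bar R)) => //.
  by congr fine; exact: diracT.
have [gint gE] := IH (fun i => f (lift ord0 i)) (fun i => fint _).
set g := (fun x : n.-tuple _ => _) in gint gE.
pose F (x : n.+1.-tuple (measurableTypeR R)) := \prod_(i < n.+1) f i (tnth x i).
have FE z : F (tuple_cons z) = f ord0 z.1 * g z.2.
  rewrite /F big_ord_recl /tuple_cons tnth0; congr (_ * _).
  by apply: eq_bigr => i _; rewrite tnthS.
have mF : measurable_fun setT (EFin \o F).
  apply/measurable_EFinP; apply: measurable_prod => i _.
  have /integrableP[/measurable_EFinP mf _] := fint i.
  by apply: (measurableT_comp mf); exact: measurable_tnth.
have Fint : (mu \x lebesgue_tuple R n)%E.-integrable setT
    ((EFin \o F) \o @tuple_cons R n).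
  apply: eq_integrable (integrable_prod_fun (fint ord0) gint) => //.
  by move=> z _; rewrite /= FE.
split.
  apply: (integrable_pushforward (@measurable_tuple_cons R n) mF) => //.
rewrite /Rintegral (integral_pushforward (@measurable_tuple_cons R n) mF) //.
rewrite big_ord_recl -gE -Rintegral_prod_fun//.
by congr fine; apply: eq_integral => z _; rewrite /= FE.
Qed.
End tuple_functions.

(** * The inner product on square integrable classes *)

Section L2_inner_product.
Context d (T : measurableType d) (R : realType).
Variable mu : {measure set T -> \bar R}.
Implicit Types u v e : L2 mu.

Lemma ae_eq_Rintegral (f g : T -> R) : measurable_fun setT f ->
  measurable_fun setT g -> f = g %[ae mu] -> \int[mu]_x f x = \int[mu]_x g x.
Proof.
move=> mf mg fg; congr fine; apply: ae_eq_integral => //.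
- exact/measurable_EFinP.
- exact/measurable_EFinP.
- exact: (ae_eq_comp EFin fg).
Qed.

Lemma integrable_L2_mul u v :
  mu.-integrable setT (EFin \o (fun x => u x * v x)).
Proof. exact/Lfun1_integrable/Lfun2_mul_Lfun1/L2_fun_Lfun/L2_fun_Lfun. Qed.

Lemma L2_innerC u v : L2_inner u v = L2_inner v u.
Proof. by apply: eq_Rintegral => x _; rewrite mulrC. Qed.

Lemma L2_innerDl a u v e :
  L2_inner (a *: u + v) e = a * L2_inner u e + L2_inner v e.
Proof.
have mL (w : L2 mu) := measurable_L2_fun w.
rewrite /L2_inner -RintegralZl//; last exact: integrable_L2_mul.
rewrite -RintegralD//; last 2 first.
- exact: (integrableZl measurableT a (integrable_L2_mul u e)).
- exact: integrable_L2_mul.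
apply: ae_eq_Rintegral.
- exact: measurable_funM.
- by apply: measurable_funD; do ?apply: measurable_funM.
have := L2_addE (a *: u) v; have := L2_scaleE a u.
apply: filterS2 => x su au _; rewrite au// /= su//.
by rewrite mulrDl mulrA.
Qed.

Lemma L2_inner_class (f g : LfunType mu (lee1n 2)) :
  L2_inner (L2_class f) (L2_class g) = \int[mu]_x (f x * g x).
Proof.
apply: ae_eq_Rintegral.
- by apply: measurable_funM; exact: measurable_L2_fun.
- by apply: measurable_funM; exact: measurable_funPT.
have := L2_classE f; have := L2_classE g.
by apply: filterS2 => x fg gg _; rewrite fg// gg.
Qed.

End L2_inner_product.

(** * Inner products of actuators and eigenfunctions *)

Section pairing.
Variables (R : realType) (bc : boundary_condition) (d : nat) (L : 'I_d -> R).
Variables (r : R) (M : nat).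
Hypotheses (L0 : forall n, 0 < L n) (r01 : 0 < r < 1).

(** In units of half a cell, the side is [`]0, 2 M[] and the interval of index [j]
is [`]2 j - 1 - r, 2 j - 1 + r[], with [r < 1].  The inclusion makes the
restriction of the measure to [Omega] invisible in the inner products. *)
Lemma omega_subset_Omega (j : {ffun 'I_d -> 'I_M}) :
  omega L r j `<=` Omega bc L.
Proof.
have /andP[r0 r1] := r01.
move=> x jx n; move: (jx n); rewrite /omega1 /= in_itv /= => /andP[lx ux].
have M0 : 0 < M%:R :> R by rewrite ltr0n; case: (M) (j n) => // -[].
have w0 : 0 < L n / (2 * M%:R) by rewrite divr_gt0// mulr_gt0.
have jM : ((j n).+1%:R : R) <= M%:R by rewrite ler_nat.
have j1 : (1 : R) <= (j n).+1%:R by rewrite ler1n.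
set w := L n / (2 * M%:R) in w0.
have cE : Defs.center M (L n) (j n).+1 = (2 * (j n).+1%:R - 1) * w.
  by rewrite /Defs.center mulrA.
have rE : r * L n / (2 * M%:R) = r * w by rewrite mulrA.
have LE : L n = 2 * M%:R * w by rewrite /w mulrC divfK// gt_eqF// mulr_gt0.
rewrite cE rE in lx ux.
have x0 : 0 < tnth x n.
  by apply: le_lt_trans lx; rewrite -mulrBl mulr_ge0// ?ltW//; lra.
have xL : tnth x n < L n.
  by apply: lt_le_trans ux _; rewrite LE -mulrDl ler_pM2r//; lra.
by rewrite /side; case: bc; rewrite /= in_itv /= ?x0 ?xL ?(ltW x0).
Qed.

(** The eigenfunction cut off to the support of the actuator is again a product
of functions of one variable, namely of the cut-off factors. *)
Lemma inner_actuator_eigenfun (i j : {ffun 'I_d -> 'I_M}) :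
  L2_inner (actuator bc L r i) (aux_eigenfun bc L j) =
  \prod_n pairing1_mx bc r M (L n) (i n) (j n).
Proof.
rewrite /actuator /aux_eigenfun L2_inner_class /=.
pose f n : R -> R := eigenfun1 bc (L n) (j n).+1 \_ (omega1 r M (L n) (i n).+1).
have mo n : measurable (omega1 r M (L n) (i n).+1 : set (measurableTypeR R)).
  exact: measurable_itv.
transitivity (\int[@Omega_measure R bc d L]_(x in omega L r i) eigenfun bc L j x).
  rewrite [RHS]Rintegral_mkcond; apply: eq_Rintegral => x _.
  by rewrite patchE indicE; case: (x \in _); rewrite ?mul1r ?mul0r.
transitivity (\int[lebesgue_tuple R d]_(x in omega L r i) eigenfun bc L j x).
  congr fine; apply: eq_measure_integral => A mA Ai.
  rewrite /= /Omega_measure /mrestr setIidl//.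
  by apply: subset_trans Ai _; exact: omega_subset_Omega.
rewrite Rintegral_mkcond.
have -> : eigenfun bc L j \_ (omega L r i) = fun x => \prod_n f n (tnth x n).
  apply/funext => x; rewrite patchE; case: ifPn => [xi|xi].
    apply: eq_bigr => n _; rewrite /f patchE ifT//.
    by move: xi; rewrite !inE => /(_ n).
  have [n xn] : exists n, tnth x n \notin omega1 r M (L n) (i n).+1.
    apply/not_existsP => h; move/negP: xi; apply; rewrite inE => n.
    by have /negP := h n; rewrite negbK inE.
  by rewrite (bigD1 n)//= /f patchE (negbTE xn) mul0r.
have fint n : (@lebesgue_measure R).-integrable setT (EFin \o f n).
  rewrite /f -restrict_EFin.
  set a := (Defs.center M (L n) (i n).+1 - r * L n / (2 * M%:R)).
  set b := (Defs.center M (L n) (i n).+1 + r * L n / (2 * M%:R)).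
  suff : (@lebesgue_measure R).-integrable [set` `]a, b[]
      (EFin \o eigenfun1 bc (L n) (j n).+1).
    by move=> h; exact: (iffLR (integrable_mkcond _ (mo n)) h).
  apply: (@integrableS _ (measurableTypeR R) _ _ [set` `[a, b]]) => //.
  - exact: subset_itv_oo_cc.
  - apply: continuous_compact_integrable; first exact: segment_compact.
    by apply: continuous_subspaceT; exact: continuous_eigenfun1.
have [_ ->] := tuple_prod_fun fint.
by apply: eq_bigr => n _; rewrite /f -Rintegral_mkcond mxE.
Qed.

End pairing.

(** * The direct sum *)

Theorem lemma2p9 (R : realType) (d : nat) (L : 'I_d -> R) (r : R)
    (bc : boundary_condition) (M : nat) :
  (1 <= d <= 3)%N ->
  (forall n : 'I_d, 0 < L n) ->
  0 < r < 1 ->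
  (0 < M)%N ->
  direct_sum (actuator_space bc L r M)
    (orthogonal_complement (eigenfun_space bc L M)).
Proof.
move=> _ L0 r01 M0.
have [H [GH HG]] := tensor_unit (fun n => pairing1_unit bc r01 M0 (L0 n)).
apply: (@direct_sum_of_pairing _ _ _ _ _ _ H).
- exact: L2_innerDl.
- by move=> a u e e'; rewrite !(L2_innerC u) L2_innerDl.
- move=> i k; rewrite -GH; apply: eq_bigr => j _.
  by rewrite inner_actuator_eigenfun.
- move=> i k; rewrite -HG; apply: eq_bigr => j _.
  by rewrite inner_actuator_eigenfun.
Qed.
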